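(* Let $m\geq 3$ be an integer and $\mathbb{F}_{2^m}^*=\mathbb{F}_{2^m}\setminus\{0\}$. For each integer $k$ with $3\leq k\leq 2^m-4$, let $W_k=\{B\subseteq \mathbb{F}_{2^m}^* : |B|=k \text{ and } \sum_{x\in B}x=0\}$. Then the pair $(\mathbb{F}_{2^m}^*,W_k)$ is a $(2^m-1,k,\lambda_k)$-BIBD for some positive integer $\lambda_k$; that is, every pair of distinct elements of $\mathbb{F}_{2^m}^*$ is contained in exactly $\lambda_k$ blocks of $W_k$.
   Context: A $(v,k,\lambda)$-BIBD (balanced incomplete block design), for positive integers $v>k\geq 2$ and $\lambda$, is a pair $(X,\mathcal{B})$ where $X$ is a set of $v$ points, $\mathcal{B}$ is a collection of $k$-subsets (blocks) of $X$, and every pair of distinct points is contained in exactly $\lambda$ blocks. *)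

(* Defs.v *)
From mathcomp Require Import all_boot all_order all_algebra all_field.

Set Implicit Arguments.
Unset Strict Implicit.
Unset Printing Implicit Defensive.

Import GRing.Theory.

(* A block family without repeated blocks; the point set is a subset [X] of an
   ambient finite type. *)
Definition is_BIBD (T : finType) (v k lambda : nat)
    (X : {set T}) (Bs : {set {set T}}) : Prop :=
  [/\ 2 <= k < v,
      0 < lambda,
      #|X| = v,
      forall B : {set T}, B \in Bs -> B \subset X /\ #|B| = k
    & forall x y : T, x \in X -> y \in X -> x != y ->
        #|[set B in Bs | (x \in B) && (y \in B)]| = lambda].

Definition nonzero (F : finFieldType) : {set F} := [set x : F | x != 0%R].

Definition W (F : finFieldType) (k : nat) : {set {set F}} :=
  [set B : {set F} | [&& B \subset nonzero F, #|B| == k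
                       & (\sum_(x in B) x)%R == 0%R]].

(* Main.v *)
From HB Require Import structures.
Require Import Defs.
From mathcomp Require Import all_boot all_order all_algebra all_field.
From mathcomp Require Import zify.

(** Two distinct nonzero vectors over F_2 are linearly independent, so the
    F_2-linear automorphisms of F permute the blocks and act transitively on
    ordered pairs of distinct points; hence the number of blocks through a pair
    is constant. It is positive as soon as some block exists. Since the elements
    of F^* add up to 0, complementation exchanges sizes k and 2^m - 1 - k, so k
    may be taken less than 2^(m-1). Then a set A of k - 2 points with sum s != 0
    can be completed by two points z and z + s, because at most 2k - 2 values of
    z are excluded. *)

Set Implicit Arguments.
Unset Strict Implicit.
Unset Printing Implicit Defensive.

Import GRing.Theory VectorInternalTheory.

Local Open Scope ring_scope.

Lemma F2_eq01 (a : 'F_2) : a = 0 \/ a = 1.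
Proof.
by case: a => [[|[|//]] i]; [left | right]; apply: val_inj.
Qed.

(** A row in the left kernel amounts to two coefficients, each 0 or 1, so only four relations have
    to be examined. *)
Lemma row_free_F2_pair n (u v : 'rV['F_2]_n) :
  u != 0 -> v != 0 -> u != v -> row_free (col_mx u v).
Proof.
move=> u0 v0 uv; rewrite -kermx_eq0; apply/eqP/row_matrixP => i.
rewrite row0; set w := row i _.
have : w *m col_mx u v = 0 by rewrite -row_mul mulmx_ker row0.
rewrite -[w]hsubmxK mul_row_col [lsubmx w]mx11_scalar [rsubmx w]mx11_scalar.
rewrite !mul_scalar_mx.
have [->|->] := F2_eq01 (lsubmx w 0 0); have [->|->] := F2_eq01 (rsubmx w 0 0).
- by rewrite !raddf0 row_mx0.
- by rewrite scale0r scale1r add0r => /eqP; rewrite (negPf v0).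
- by rewrite scale0r scale1r addr0 => /eqP; rewrite (negPf u0).
(* Both coefficients are 1: then [u = - v], which over F_2 means [u = v]. *)
rewrite !scale1r => /eqP; rewrite addr_eq0 => /eqP uNv.
case/eqP: uv; rewrite uNv; apply/rowP => j; rewrite mxE.
by have [->|->] := F2_eq01 (v 0 j); apply: val_inj.
Qed.

Lemma ex_notin (T : finType) (A : {set T}) :
  (#|A| < #|T|)%N -> exists x, x \notin A.
Proof.
move=> ltA; have [x] : exists x, x \in ~: A.
  by apply/card_gt0P; rewrite cardsCs setCK subn_gt0.
by rewrite inE; exists x.
Qed.

Lemma ex_subset_card (T : finType) (A : {set T}) j :
  (j <= #|A|)%N -> exists2 B : {set T}, B \subset A & #|B| = j.
Proof.
rewrite -bin_gt0 -cards_draws => /card_gt0P[B]; rewrite inE => /andP[BA /eqP Bj].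
by exists B.
Qed.

Section Characteristic2.

Variable F : finFieldType.
Hypothesis char2 : 2%N \in [pchar F].

(** In F_2-coordinates both pairs become row-free two-row matrices [U] and [V]; a linear map taking
    [U] to [V] preserves the rank of [U], so it agrees on the rows of [U] with an invertible
    matrix. *)
Lemma additive_2transitive (x y x' y' : F) :
    x != 0 -> y != 0 -> x != y -> x' != 0 -> y' != 0 -> x' != y' ->
  exists g : {additive F -> F}, [/\ injective g, g x = x' & g y = y'].
Proof.
move=> x0 y0 xy x'0 y'0 x'y'.
pose L := pPrimeCharType char2.
pose vec (z : F) := v2r (z : L).
have free (z t : F) : z != 0 -> t != 0 -> z != t ->
    row_free (col_mx (vec z) (vec t)).
  by move=> z0 t0 zt; apply: row_free_F2_pair;
    rewrite -?(raddf0 (v2r : L -> _)) (inj_eq (can_inj v2rK)).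
have freeU := free _ _ x0 y0 xy; have freeV := free _ _ x'0 y'0 x'y'.
set U := col_mx _ _ in freeU; set V := col_mx _ _ in freeV.
have UV : U *m (pinvmx U *m V) = V by rewrite mulmxA mulmxVp ?mul1mx.
have [|g gU] := @complete_unitmx _ _ _ U (pinvmx U *m V).
  by rewrite UV (eqP freeU) (eqP freeV).
rewrite UV mul_col_mx => /esym/eq_col_mx [gx gy].
pose h (z : F) : F := (r2v (vec z *m g) : L).
have hB : zmod_morphism h.
  by move=> z t; rewrite /h /vec raddfB mulmxBl raddfB.
pose hM := GRing.isZmodMorphism.Build F F h hB.
pose hA : {additive F -> F} := HB.pack h hM.
exists hA; split.
- move=> z t /(congr1 (v2r : L -> _)); rewrite !r2vK => zt.
  exact/(can_inj (v2rK : cancel (v2r : L -> _) _))/(can_inj (mulmxK gU)).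
- by rewrite /= /h gx /vec v2rK.
by rewrite /= /h gy /vec v2rK.
Qed.

(** Taking images under an additive injection [g] with [g x = x'] and [g y = y'] sends blocks
    injectively to blocks, as [g] preserves size, zero sum and avoidance of 0. Exchanging the two
    pairs gives equality. *)
Lemma leq_blocks_through k (x y x' y' : F) :
    x \in nonzero F -> y \in nonzero F -> x != y ->
    x' \in nonzero F -> y' \in nonzero F -> x' != y' ->
  (#|[set B in W F k | (x \in B) && (y \in B)]| <=
     #|[set B in W F k | (x' \in B) && (y' \in B)]|)%N.
Proof.
rewrite !inE => x0 y0 xy x'0 y'0 x'y'.
have [g [g_inj gx gy]] := additive_2transitive x0 y0 xy x'0 y'0 x'y'.
rewrite -(card_imset _ (imset_inj g_inj)); apply/subset_leq_card/subsetP.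
move=> _ /imsetP[B + ->]; rewrite !inE => /andP[/and3P[B0 Bk Bs] /andP[xB yB]].
rewrite -gx -gy !imset_f // (card_imset _ g_inj) Bk !andbT /=.
rewrite (big_imset _ (in2W g_inj)) /= -raddf_sum (eqP Bs) raddf0 eqxx andbT.
apply/subsetP => _ /imsetP[z zB ->]; rewrite inE -(raddf0 g) (inj_eq g_inj).
by have := subsetP B0 _ zB; rewrite inE.
Qed.

Lemma card_nonzero : #|nonzero F| = #|F|.-1.
Proof. by rewrite -(cardC1 0); apply: eq_card => x; rewrite !inE. Qed.

Lemma ex_block_small k : (3 <= k)%N -> (k.*2 < #|F|)%N ->
  exists B, B \in W F k.
Proof.
case: k => [|[|[|j]]] // _ ltk.
have [|A0 A0nz A0j] := @ex_subset_card _ (nonzero F) j.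
  by rewrite card_nonzero; lia.
(* Avoiding the sum of [A0] makes [s] nonzero, since -1 = 1 here. *)
have [|y] := @ex_notin F (0 |: (\sum_(x in A0) x |: A0)).
  by apply: leq_trans ltk; rewrite !cardsU1 A0j; lia.
rewrite !inE !negb_or => /and3P[y0 ys yA0].
pose s := y + \sum_(x in A0) x.
have s0 : s != 0 by rewrite addr_eq0 oppr_pchar2.
pose A := y |: A0.
have Aj : #|A| = j.+1 by rewrite cardsU1 yA0 A0j.
have Anz : A \subset nonzero F by rewrite subUset A0nz sub1set inE y0.
have As : \sum_(x in A) x = s by rewrite big_setU1.
(* The translate by [s] keeps [s + z] as well as [z] nonzero and outside [A]. With k = j + 3, each
   of the two sets has at most j + 2 = k - 1 elements. *)
have [|z] := @ex_notin F ((0 |: A) :|: [set s + x | x in 0 |: A]).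
  apply: leq_ltn_trans (leq_card_setU _ _) _.
  rewrite card_imset; last exact: addrI.
  by apply: leq_trans ltk; rewrite cardsU1 Aj; lia.
rewrite inE negb_or => /andP[z0A zsA].
have zs0A : s + z \notin 0 |: A.
  apply: contra zsA => szA; apply/imsetP; exists (s + z) => //.
  by rewrite addrA addrr_pchar2 ?add0r.
move: z0A zs0A; rewrite !(in_setU1 _ 0) !negb_or => /andP[z0 zA] /andP[sz0 szA].
(* The two added points differ because [s] is nonzero. *)
have zU : z \notin (s + z) |: A.
  rewrite in_setU1 negb_or zA andbT -{1}[z]add0r (inj_eq (addIr z)).
  by rewrite eq_sym.
exists (z |: ((s + z) |: A)); rewrite inE cardsU1 zU cardsU1 szA Aj eqxx.
rewrite subUset sub1set inE z0 subUset sub1set inE sz0 Anz /=.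
rewrite (big_setU1 _ zU) (big_setU1 _ szA) /= As.
by rewrite addrCA [z + s]addrC addrr_pchar2.
Qed.

(** Multiplication by some [c] other than 0 and 1 permutes the nonzero elements, so the sum [S]
    satisfies [c * S = S]. *)
Lemma sum_nonzero : (2 < #|F|)%N -> \sum_(x in nonzero F) x = 0.
Proof.
move=> F2; have [|c] := @ex_notin F [set 0; 1 : F].
  by rewrite cards2 eq_sym oner_eq0.
rewrite !inE negb_or => /andP[c0 c1].
set S := \sum_(x in _) x.
have : c * S = S.
  rewrite mulr_sumr /S [RHS](reindex_inj (mulfI c0)) /=.
  by apply: eq_bigl => x; rewrite !inE mulf_eq0 (negPf c0).
move/eqP; rewrite -subr_eq0 -{2}[S]mul1r -mulrBl mulf_eq0 subr_eq0 (negPf c1).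
by move/eqP.
Qed.

Lemma complement_block k B : (2 < #|F|)%N ->
  B \in W F k -> nonzero F :\: B \in W F (#|F|.-1 - k).
Proof.
move=> F2; rewrite !inE => /and3P[Bnz /eqP Bk /eqP Bs].
rewrite subsetDl cardsD (setIidPr Bnz) Bk card_nonzero eqxx /=.
have := sum_nonzero F2; rewrite (big_setID B) /= (setIidPr Bnz) Bs add0r.
by move->.
Qed.

Lemma ex_block k : (3 <= k)%N -> (k <= #|F| - 4)%N -> ~~ odd #|F| ->
  exists B, B \in W F k.
Proof.
move=> k3 kF oF; have [ltk|gek] := ltnP k.*2 #|F|; first exact: ex_block_small.
(* The upper bound on [k] makes the complementary size at least 3; [gek] makes its double at most
   [#|F| - 2]. *)
have [||B BW] := @ex_block_small (#|F|.-1 - k); [lia | lia |].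
have -> : k = (#|F|.-1 - (#|F|.-1 - k))%N by lia.
by exists (nonzero F :\: B); apply: complement_block => //; lia.
Qed.

End Characteristic2.

Local Close Scope ring_scope.

Theorem theorem2p7 (m : nat) (hm : 3 <= m)
    (F : finFieldType) (hF : #|F| = 2 ^ m)
    (k : nat) (hk3 : 3 <= k) (hk : k <= 2 ^ m - 4) :
  exists lambda : nat, is_BIBD (2 ^ m - 1) k lambda (nonzero F) (W F k).
Proof.
have char2 : 2 \in [pchar F]%R by apply: card_finPcharP hF _.
have [||B BW] := ex_block char2 hk3; [by rewrite hF | | ].
  by rewrite hF oddX; case: (m) hm.
have /and3P[Bnz /eqP Bk _] : [&& B \subset nonzero F, #|B| == k
    & (\sum_(x in B) x)%R == 0%R] by move: BW; rewrite inE.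
(* Two points of an existing block serve as reference pair: its count defines lambda, and [B] itself
   makes it positive. *)
have /card_gt1P[a [b [aB bB ab]]] : 1 < #|B| by rewrite Bk; apply: ltnW.
have aF := subsetP Bnz _ aB; have bF := subsetP Bnz _ bB.
exists #|[set C in W F k | (a \in C) && (b \in C)]|; split.
- by lia.
- by apply/card_gt0P; exists B; rewrite inE BW aB bB.
- by rewrite card_nonzero hF subn1.
- by move=> C; rewrite inE => /and3P[CF /eqP Ck _].
by move=> x y xF yF xy; apply/eqP; rewrite eqn_leq !leq_blocks_through.
Qed.
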